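(* Let $G$ be a finite simple connected graph with at least one edge, with maximum degree $\Delta$ and minimum degree $\delta$. Then $$\frac{2\delta}{\Delta^2+\delta^2}\sqrt{\delta\Delta M_2(G)R_{-1}(G)}\le GA_1(G)\le \sqrt{M_2(G)R_{-1}(G)},$$ and equality (in either bound) is attained if and only if $G$ is a regular graph.
   Context: For a graph $G$ with vertex set $V(G)$ and edge set $E(G)$, $d_u$ denotes the degree of the vertex $u$. The first geometric-arithmetic index is $GA_1(G)=\sum_{uv\in E(G)}\frac{2\sqrt{d_ud_v}}{d_u+d_v}$. The second Zagreb index is $M_2(G)=\sum_{uv\in E(G)} d_ud_v$. Also $R_{-1}(G)=\sum_{uv\in E(G)}\frac{1}{d_ud_v}$ (the general Randić index $R_\alpha(G)=\sum_{uv\in E(G)}(d_ud_v)^\alpha$ with $\alpha=-1$). *)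

(* Defs.v *)
From mathcomp Require Import all_boot all_order all_algebra.

Set Implicit Arguments.
Unset Strict Implicit.
Unset Printing Implicit Defensive.

Import Order.TTheory GRing.Theory Num.Theory.
Local Open Scope ring_scope.

Record sgraph := SGraph {
  vertex :> finType;
  adj : rel vertex;
  adj_sym : symmetric adj;
  adj_irrefl : irreflexive adj }.

Section Graph.
Variable G : sgraph.

Definition edges : {set {set G}} :=
  [set e : {set G} | [exists u, exists v, adj u v && (e == [set u; v])]].

Definition degree (u : G) : nat := #|[set v | adj u v]|.

Definition max_degree : nat := (\max_(u : G) degree u)%N.

(* Every degree is < #|G|, so the default value #|G| is inert as soon as G has
   a vertex. *)
Definition min_degree : nat := \big[minn/#|G|]_(u : G) degree u.

Definition connected_graph : Prop := forall u v : G, connect (@adj G) u v.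

Definition regular : Prop := exists k : nat, forall u : G, degree u = k.

End Graph.

Section Indices.
Variables (R : rcfType) (G : sgraph).

(* An edge e = uv is the two-element set {u, v}: the product and the sum of the
   degrees over e are d_u d_v and d_u + d_v. *)
Definition deg_prod (e : {set G}) : R := \prod_(w in e) (degree w)%:R.
Definition deg_sum (e : {set G}) : R := \sum_(w in e) (degree w)%:R.

Definition GA1 : R :=
  \sum_(e in edges G) 2 * Num.sqrt (deg_prod e) / deg_sum e.

Definition M2 : R := \sum_(e in edges G) deg_prod e.

(* The general Randic index R_alpha for alpha = -1. *)
Definition randic_m1 : R := \sum_(e in edges G) 1 / deg_prod e.

End Indices.

(* Main.v *)
(** Write m for the number of edges and p = d_u d_v for an edge uv.  By AM-GM
    each term of GA_1 is at most 1, so GA_1 <= m, and m^2 <= M_2 R_{-1} by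
    Cauchy-Schwarz; equality forces d_u = d_v along every edge, and connectedness
    propagates this.  For the lower bound, delta^2 <= p <= Delta^2 gives
    Schweitzer's inequality
    2 delta Delta sqrt(M_2 R_{-1}) <= (Delta^2 + delta^2) m, so the left-hand side
    is at most m sqrt(delta Delta) / Delta; and each term of GA_1 is at least
    sqrt(delta Delta) / Delta, strictly so unless delta = Delta. *)
Require Import Defs.
From mathcomp Require Import all_boot all_order all_algebra.
From mathcomp Require Import ring.
Import Order.TTheory GRing.Theory Num.Theory.
Local Open Scope ring_scope.

Set Implicit Arguments.
Unset Strict Implicit.

(** * Sums of a positive family and of its inverses *)

(** Cauchy-Schwarz by its quadratic form: summing [(f i - t) ^+ 2 / f i >= 0] over [i] gives [quad]
    for every [t], and one good choice of [t] concludes. *)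
Lemma sum_sum_inv_ge (R : realFieldType) (I : finType) (P : pred I) (f : I -> R) :
  (forall i, P i -> 0 < f i) ->
  (\sum_(i | P i) 1) ^+ 2 <= (\sum_(i | P i) f i) * (\sum_(i | P i) (f i)^-1).
Proof.
move=> f_gt0.
set m := \sum_(i | P i) 1; set s := \sum_(i | P i) f i.
set r := \sum_(i | P i) (f i)^-1.
have quad t : 2 * t * m <= s + t ^+ 2 * r.
  rewrite /m /s /r !mulr_sumr -big_split /=; apply: ler_sum => i Pi.
  have fi_gt0 := f_gt0 i Pi; rewrite mulr1 -subr_ge0.
  rewrite (_ : _ - _ = (f i - t) ^+ 2 / f i); last by field; rewrite gt_eqF.
  by rewrite divr_ge0 ?sqr_ge0 // ltW.
have m_ge0 : 0 <= m by apply: sumr_ge0.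
have [m0|m_neq0] := eqVneq m 0.
  rewrite m0 expr0n mulr_ge0 //; apply: sumr_ge0 => i Pi.
    exact/ltW/f_gt0.
  by rewrite invr_ge0 ltW ?f_gt0.
have s_ge0 : 0 <= s by apply: sumr_ge0 => i /f_gt0/ltW.
have m_gt0 : 0 < m by rewrite lt_def m_neq0.
have s_gt0 : 0 < s.
  (* All [f i] being positive, [s = 0] would leave no index in [P], whence [m = 0]. *)
  rewrite lt_def s_ge0 andbT; apply: contra m_neq0 => /eqP /psumr_eq0P s0.
  rewrite /m big1 // => i Pi; have := f_gt0 i Pi.
  by rewrite s0 ?ltxx // => j /f_gt0/ltW.
(* The minimum over t of the quadratic s - 2 t m + t^2 r is attained at m / r,
   but t = s / m avoids discussing r = 0. *)
have := quad (s / m); rewrite (_ : 2 * _ * m = 2 * s); last by field.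
rewrite (_ : s + _ = s + s * (s * r) / m ^+ 2); last by field.
have -> : 2 * s = s + s by ring.
rewrite lerD2l ler_pdivlMr ?exprn_gt0 // ler_pM2l //.
Qed.

(* Schweitzer's inequality: sum [f i + (a b)^2 / f i <= a^2 + b^2] over i, then
   bound the left-hand side below by AM-GM. *)
Lemma sum_sum_inv_le (R : rcfType) (I : finType) (P : pred I) (f : I -> R)
    (a b : R) :
  0 <= a -> 0 <= b ->
  (forall i, P i -> [/\ 0 < f i, a ^+ 2 <= f i & f i <= b ^+ 2]) ->
  2 * (a * b) *
    Num.sqrt ((\sum_(i | P i) f i) * (\sum_(i | P i) (f i)^-1)) <=
  (b ^+ 2 + a ^+ 2) * \sum_(i | P i) 1.
Proof.
move=> a_ge0 b_ge0 f_bnd.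
set m := \sum_(i | P i) 1; set s := \sum_(i | P i) f i.
set r := \sum_(i | P i) (f i)^-1.
have s_ge0 : 0 <= s by apply: sumr_ge0 => i /f_bnd[/ltW].
have r_ge0 : 0 <= r by apply: sumr_ge0 => i /f_bnd[/ltW]; rewrite invr_ge0.
have lin : s + (a * b) ^+ 2 * r <= (b ^+ 2 + a ^+ 2) * m.
  rewrite /m /s /r !mulr_sumr -big_split /=; apply: ler_sum => i /f_bnd.
  move=> [fi_gt0 af fb]; rewrite mulr1 -subr_ge0.
  rewrite (_ : _ - _ = (f i - a ^+ 2) * (b ^+ 2 - f i) / f i).
    by rewrite divr_ge0 ?(ltW fi_gt0) // mulr_ge0 // subr_ge0.
  by field; rewrite gt_eqF.
apply: le_trans lin; rewrite sqrtrM // -subr_ge0.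
rewrite -{1}(sqr_sqrtr s_ge0) -{1}(sqr_sqrtr r_ge0).
rewrite (_ : _ - _ = (Num.sqrt s - a * b * Num.sqrt r) ^+ 2); last by ring.
exact: sqr_ge0.
Qed.

(** * A single term of the index, with [x] and [y] the degrees of the endpoints *)

Section GATerm.
Variables (R : rcfType) (x y : R).
Hypotheses (x_gt0 : 0 < x) (y_gt0 : 0 < y).

Lemma ga_term_le1 : 2 * Num.sqrt (x * y) / (x + y) <= 1 ?= iff (x == y).
Proof.
have xy_gt0 : 0 < x + y by rewrite addr_gt0.
have xE := sqr_sqrtr (ltW x_gt0); have yE := sqr_sqrtr (ltW y_gt0).
have dE : 1 - 2 * Num.sqrt (x * y) / (x + y)
          = (Num.sqrt x - Num.sqrt y) ^+ 2 / (x + y).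
  rewrite sqrtrM ?(ltW x_gt0) // sqrrB xE yE.
  by field; rewrite gt_eqF.
split; first by rewrite -subr_ge0 dE divr_ge0 ?sqr_ge0 // ltW.
rewrite eq_sym -subr_eq0 dE mulf_eq0 invr_eq0 (gt_eqF xy_gt0) orbF sqrf_eq0.
by rewrite subr_eq0 eqr_sqrt ?ltW.
Qed.

(** Squaring and clearing denominators turns the strict case into
    [d * (x + y) ^+ 2 < 4 * (x * y) * D], symmetric in [x] and [y], so that they may be ordered. *)
Lemma ga_term_ge (d D : R) : d <= x <= D -> d <= y <= D -> 0 <= d ->
  Num.sqrt (d * D) / D <= 2 * Num.sqrt (x * y) / (x + y) ?= iff (d == D).
Proof.
move=> xb yb d_ge0; have xy_gt0 : 0 < x + y by rewrite addr_gt0.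
have [dx xD] := andP xb; have [dy yD] := andP yb.
have D_gt0 : 0 < D by apply: lt_le_trans xD.
(* If [d = D], both [x] and [y] are squeezed to [D] and both sides equal 1. *)
have [dD|dD] := eqVneq d D.
  have xE : x = D by apply/le_anti; rewrite xD -dD dx.
  have yE : y = D by apply/le_anti; rewrite yD -dD dy.
  rewrite dD xE yE -expr2 sqrtr_sqr gtr0_norm //.
  rewrite (_ : 2 * D / _ = D / D); first exact/leif_refl.
  by field; rewrite !gt_eqF ?addr_gt0.
have d_lt : d < D by rewrite lt_neqAle dD (le_trans dx xD).
suff key : Num.sqrt (d * D) / D < 2 * Num.sqrt (x * y) / (x + y).
  by split; [exact: ltW | rewrite lt_eqF].
have poly (u v : R) : 0 < u -> d <= u -> u <= v -> v <= D ->
    d * (u + v) ^+ 2 < 4 * (u * v) * D.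
  move=> u_gt0 du uv vD; have v_gt0 := lt_le_trans u_gt0 uv.
  have uv_gt0 : 0 < u * v by rewrite mulr_gt0.
  (* The three nonnegative terms vanish together only if d = u = v = D. *)
  rewrite -subr_gt0 (_ : _ - _ = 4 * (u * v) * (D - v) + (u - d) * (u + v) ^+ 2
    + u * (v - u) * (3 * v + u)); last by ring.
  have cv : 0 < 4 * (u * v) by rewrite mulr_gt0.
  have cu : 0 < u + v by rewrite addr_gt0.
  have cw : 0 < 3 * v + u by rewrite addr_gt0 ?mulr_gt0.
  have p1 : 0 <= 4 * (u * v) * (D - v) by rewrite pmulr_rge0 ?subr_ge0.
  have p2 : 0 <= (u - d) * (u + v) ^+ 2 by rewrite mulr_ge0 ?sqr_ge0 ?subr_ge0.
  have p3 : 0 <= u * (v - u) * (3 * v + u).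
    by rewrite pmulr_lge0 // pmulr_rge0 ?subr_ge0.
  rewrite lt_def !addr_ge0 // andbT !paddr_eq0 ?addr_ge0 //.
  rewrite !mulf_eq0 pnatr_eq0 (gt_eqF u_gt0) (gt_eqF v_gt0) (gt_eqF cu).
  rewrite (gt_eqF cw) /= !orbF !subr_eq0; apply: contra dD.
  by move=> /andP[/andP[/eqP-> /eqP<-] /eqP->].
have ineq : d * (x + y) ^+ 2 < 4 * (x * y) * D.
  have [xy|yx] := leP x y; first exact: poly.
  by rewrite addrC [x * y]mulrC; apply: poly => //; apply: ltW.
(* Both sides are nonnegative: written as square roots of their squares, they are compared through
   these squares. *)
rewrite -[ltLHS]ger0_norm ?divr_ge0 ?sqrtr_ge0 ?ltW //.
rewrite -[ltRHS]ger0_norm ?divr_ge0 ?mulr_ge0 ?sqrtr_ge0 ?(ltW xy_gt0) //.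
rewrite -!sqrtr_sqr ltr_sqrt; last first.
  by rewrite exprn_gt0 // !(divr_gt0, mulr_gt0, sqrtr_gt0).
rewrite !expr_div_n exprMn !sqr_sqrtr ?mulr_ge0 ?(ltW x_gt0) ?(ltW y_gt0) //;
  last exact: ltW.
rewrite -subr_gt0.
rewrite (_ : _ - _ = (4 * (x * y) * D - d * (x + y) ^+ 2) / (D * (x + y) ^+ 2)).
  by rewrite divr_gt0 ?subr_gt0 // mulr_gt0 // exprn_gt0.
by field; rewrite !gt_eqF.
Qed.

End GATerm.

(** * Degrees, edges and regularity *)

Section Graph.
Variable G : sgraph.

Lemma degree_le_max (u : G) : (degree u <= max_degree G)%N.
Proof. exact: leq_bigmax. Qed.

Lemma min_degree_le (u : G) : (min_degree G <= degree u)%N.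
Proof.
rewrite /min_degree; have := mem_index_enum u.
elim: (index_enum _) => // v s IH; rewrite inE big_cons geq_min.
by case/predU1P => [->|/IH->]; rewrite ?leqnn ?orbT.
Qed.

Lemma regular_min_max (u : G) :
  min_degree G = max_degree G <-> regular G.
Proof.
split=> [mM|[k degk]].
  exists (max_degree G) => v; apply/eqP; rewrite eqn_leq degree_le_max.
  by rewrite -mM min_degree_le.
apply/eqP; rewrite eqn_leq (leq_trans (min_degree_le u) (degree_le_max u)) /=.
have -> : max_degree G = k.
  apply/eqP; rewrite eqn_leq -{2}(degk u) degree_le_max andbT.
  by apply/bigmax_leqP => v _; rewrite degk.
rewrite /min_degree; apply: (big_ind (fun n => (k <= n)%N)) => [|m n km kn|v _].
(* The default value [#|G|] of the minimum must be at least [k] too; the vertex [u] shows it. *)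
- by rewrite -(degk u) max_card.
- by rewrite leq_min km.
- by rewrite degk.
Qed.

(** Destructing this exposes the endpoints of an edge and rewrites its degree product and sum
    together, in the form used by the termwise bounds. *)
Variant edge_spec (R : rcfType) (e : {set G}) : Prop :=
  EdgeSpec (u v : G) of adj u v & deg_prod R e = (degree u)%:R * (degree v)%:R
    & deg_sum R e = (degree u)%:R + (degree v)%:R.

Lemma deg_pair (R : rcfType) (u v : G) : adj u v ->
  deg_prod R [set u; v] = (degree u)%:R * (degree v)%:R /\
  deg_sum R [set u; v] = (degree u)%:R + (degree v)%:R.
Proof.
move=> uv; have u_neq_v : u \notin [set v].
  by rewrite inE; apply: contraTneq uv => ->; rewrite adj_irrefl.
by rewrite /deg_prod /deg_sum !big_setU1 //= !big_set1.
Qed.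

Lemma edgeP (R : rcfType) (e : {set G}) : e \in edges G -> edge_spec R e.
Proof.
rewrite inE => /existsP[u /existsP[v /andP[uv /eqP->]]].
by have [pE sE] := deg_pair R uv; exists u v.
Qed.

Lemma adj_degree_gt0 (u v : G) : adj u v -> (0 < degree u)%N.
Proof. by move=> uv; apply/card_gt0P; exists v; rewrite inE. Qed.

Lemma adj_degrees_gt0 (R : rcfType) (u v : G) : adj u v ->
  0 < (degree u)%:R :> R /\ 0 < (degree v)%:R :> R.
Proof.
move=> uv; have vu : adj v u by rewrite adj_sym.
by rewrite !ltr0n (adj_degree_gt0 uv) (adj_degree_gt0 vu).
Qed.

(** The degree is constant along any path leaving [u], by induction on the path. *)
Lemma connected_adj_regular (u : G) : connected_graph G ->
  (forall v w : G, adj v w -> degree v = degree w) -> regular G.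
Proof.
move=> Gconn adj_deg; exists (degree u) => w.
have /connectP[p] := Gconn u w.
elim: p u => [|v p IH] u /=; first by move=> _ ->.
by case/andP => /adj_deg -> /IH; apply.
Qed.

End Graph.

(** * The two bounds and their equality cases *)

Unset Implicit Arguments.
Set Strict Implicit.

Theorem corollary2p14 (R : rcfType) (G : sgraph)
    (Gconn : connected_graph G) (Gedge : edges G != set0) :
  let Delta : R := (max_degree G)%:R in
  let delta : R := (min_degree G)%:R in
  let lower : R := 2 * delta / (Delta ^+ 2 + delta ^+ 2)
                   * Num.sqrt (delta * Delta * M2 R G * randic_m1 R G) in
  let upper : R := Num.sqrt (M2 R G * randic_m1 R G) in
  [/\ lower <= GA1 R G,
      GA1 R G <= upper,
      lower = GA1 R G <-> regular G
    & GA1 R G = upper <-> regular G].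
Proof.
move=> Delta delta lower upper.
have [e0 e0E] := set0Pn _ Gedge.
have [u0 v0 uv0 _ _] := edgeP R e0E.
set m : R := \sum_(e in edges G) 1.
have randicE : randic_m1 R G = \sum_(e in edges G) (deg_prod R e)^-1.
  by apply: eq_bigr => e _; rewrite div1r.
have bnd (u : G) : delta <= (degree u)%:R <= Delta.
  by rewrite !ler_nat min_degree_le degree_le_max.
have delta_ge0 : 0 <= delta by [].
have Delta_gt0 : 0 < Delta.
  have [du _] := adj_degrees_gt0 R uv0.
  by apply: lt_le_trans du _; have /andP[] := bnd u0.
have Delta_ge0 := ltW Delta_gt0.
have prod_bnd e : e \in edges G -> [/\ 0 < deg_prod R e,
    delta ^+ 2 <= deg_prod R e & deg_prod R e <= Delta ^+ 2].
  move=> /(edgeP R)[u v uv -> _]; have [du dv] := adj_degrees_gt0 R uv.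
  have /andP[? ?] := bnd u; have /andP[? ?] := bnd v.
  by rewrite mulr_gt0 // !expr2; split=> //; apply: ler_pM => //; apply: ltW.
have M2_ge0 : 0 <= M2 R G by apply: sumr_ge0 => e /prod_bnd[/ltW].
have randic_ge0 : 0 <= randic_m1 R G.
  by rewrite randicE; apply: sumr_ge0 => e /prod_bnd[/ltW]; rewrite invr_ge0.
have m_ge0 : 0 <= m by apply: sumr_ge0.
have m_le_upper : m <= upper.
  rewrite -[m]ger0_norm // -sqrtr_sqr ler_wsqrtr // randicE.
  by apply: sum_sum_inv_ge => e /prod_bnd[].
have upper_le_m : 2 * (delta * Delta) * upper <= (Delta ^+ 2 + delta ^+ 2) * m.
  by rewrite /upper randicE; apply: sum_sum_inv_le.
have GA_le_m : GA1 R G <= m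
    ?= iff [forall (e | e \in edges G),
             2 * Num.sqrt (deg_prod R e) / deg_sum R e == 1].
  apply: leif_sum => e /(edgeP R)[u v uv -> ->].
  have [du dv] := adj_degrees_gt0 R uv.
  by apply/leif_eq; case: (ga_term_le1 du dv).
have GA_ge : m * (Num.sqrt (delta * Delta) / Delta) <= GA1 R G
    ?= iff (delta == Delta).
  (* The termwise equality condition does not depend on the edge; [e0] recovers it from the
     quantified form. *)
  have -> : (delta == Delta) = [forall (e | e \in edges G), delta == Delta].
    apply/idP/forall_inP => [dD e _|/(_ e0 e0E)] //.
  rewrite mulr_suml; apply: leif_sum => e /(edgeP R)[u v uv -> ->].
  have [du dv] := adj_degrees_gt0 R uv.
  by rewrite mul1r; apply: ga_term_ge.
have sqE_gt0 : 0 < Delta ^+ 2 + delta ^+ 2.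
  by rewrite ltr_wpDr ?sqr_ge0 ?exprn_gt0.
(* The last factor is the quantity that Schweitzer's inequality bounds by [m]. *)
have lowerE : lower = Num.sqrt (delta * Delta) / Delta
    * (2 * (delta * Delta) * upper / (Delta ^+ 2 + delta ^+ 2)).
  rewrite /lower -(mulrA (delta * Delta)) sqrtrM ?mulr_ge0 // -/upper.
  by field; rewrite !gt_eqF.
have lower_le_m : lower <= m * (Num.sqrt (delta * Delta) / Delta).
  rewrite lowerE mulrC ler_wpM2r ?divr_ge0 ?sqrtr_ge0 //.
  by rewrite ler_pdivrMr // [m * _]mulrC.
have eq_regular : delta = Delta <-> regular G.
  rewrite -(regular_min_max u0); split=> [/eqP|mM].
    by rewrite eqr_nat => /eqP.
  by rewrite /delta mM.
have regular_eq : regular G -> lower = GA1 R G /\ GA1 R G = upper.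
  move=> /eq_regular dD.
  have sq1 : Num.sqrt (delta * Delta) / Delta = 1.
    by rewrite dD -expr2 sqrtr_sqr gtr0_norm // divff // gt_eqF.
  have GA_m : GA1 R G = m.
    by have := GA_ge.2; rewrite sq1 mulr1 dD eqxx => /eqP.
  have upperE : upper = m.
    apply/le_anti; rewrite m_le_upper andbT.
    (* For [delta = Delta], Schweitzer's inequality has the same positive factor on both sides and
       reads [upper <= m]. *)
    move: upper_le_m; rewrite dD (_ : 2 * _ = Delta ^+ 2 + Delta ^+ 2).
      by rewrite ler_pM2l // addr_gt0 ?exprn_gt0.
    by ring.
  rewrite GA_m upperE; split=> //.
  by rewrite lowerE upperE sq1 dD; field; rewrite gt_eqF // addr_gt0 ?exprn_gt0.
split.
- exact: le_trans lower_le_m GA_ge.1.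
- exact: le_trans GA_le_m.1 m_le_upper.
(* Equality collapses the chain through [lower_le_m] and [GA_ge], so [GA_ge] is an equality. *)
- split=> [lG|/regular_eq[]//]; apply/eq_regular/eqP.
  by rewrite -GA_ge.2 eq_le GA_ge.1 -lG.
- split=> [Gu|/regular_eq[]//].
  (* Since [m] lies between [GA1 R G] and [upper], equality forces [GA1 R G = m], hence every term
     to be 1. *)
  have /forall_inP term1 : [forall (e | e \in edges G),
      2 * Num.sqrt (deg_prod R e) / deg_sum R e == 1].
    by rewrite -GA_le_m.2 eq_le GA_le_m.1 Gu.
  apply: (connected_adj_regular u0) => // v w vw.
  have vwE : [set v; w] \in edges G.
    by rewrite inE; apply/existsP; exists v; apply/existsP; exists w; rewrite vw /=.
  have [pE sE] := deg_pair R vw; have [dv dw] := adj_degrees_gt0 R vw.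
  have := term1 _ vwE; rewrite pE sE (ga_term_le1 dv dw).2 eqr_nat.
  by move/eqP.
Qed.
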